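(* Let $a,b$ be positive integers and let $h_j=h^{a,b}_j$ denote the number of tilings of the honeycomb strip $H_j$ by monomers of $a$ colors and dimers of $b$ colors, with $h_0=1$ and $h_j=0$ for $j<0$. Then for all integers $m,n\ge 0$, $$h_{m+n}=h_mh_n+h_{m-1}\bigl(b\,h_{n-1}+ab\,h_{n-2}+b^2h_{n-3}\bigr)+h_{m-2}\bigl(ab\,h_{n-1}+b^2h_{n-2}\bigr)+b^2h_{n-1}h_{m-3}.$$
   Context: The honeycomb strip $H_n$ consists of $n$ regular hexagons arranged in two rows, numbered $1,\dots,n$ from the bottom left so that odd-numbered hexagons form the bottom row and even-numbered ones the top row; hexagon $i$ shares an edge with hexagons $i\pm1$ and $i\pm2$ (when they exist), and with no others. A monomer is a single hexagon; a dimer is a pair of edge-adjacent hexagons, i.e. either $\{i,i+1\}$ (slanted) or $\{i,i+2\}$ (horizontal). A tiling of $H_n$ is a partition of its hexagons into monomers and dimers; in a colored tiling each monomer receives one of $a$ colors and each dimer one of $b$ colors. *)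

(* Defs.v *)
From mathcomp Require Import all_boot all_order all_algebra.

Set Implicit Arguments.
Unset Strict Implicit.
Unset Printing Implicit Defensive.

(* Hexagon k of the strip H_n is the ordinal k - 1 : 'I_n. *)
Definition adjacent (n : nat) (i j : 'I_n) : bool :=
  [|| j == i + 1 :> nat, i == j + 1 :> nat, j == i + 2 :> nat | i == j + 2 :> nat].

Definition monomer (n : nat) (B : {set 'I_n}) : bool :=
  [exists i, B == [set i]].

Definition dimer (n : nat) (B : {set 'I_n}) : bool :=
  [exists i, exists j, adjacent i j && (B == [set i; j])].

Definition tiling (n : nat) (P : {set {set 'I_n}}) : bool :=
  partition P [set: 'I_n] && [forall B in P, monomer B || dimer B].

(* A coloring of the tiling P is a function on P; it is extended by None
   outside P, so that distinct functions are distinct colorings. *)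
Definition coloring (a b n : nat) (P : {set {set 'I_n}})
    (c : {ffun {set 'I_n} -> option ('I_a + 'I_b)}) : bool :=
  [forall B : {set 'I_n},
    match c B with
    | None => B \notin P
    | Some (inl _) => (B \in P) && monomer B
    | Some (inr _) => (B \in P) && dimer B
    end].

Definition colored_tilings (a b n : nat) :
    {set {set {set 'I_n}} * {ffun {set 'I_n} -> option ('I_a + 'I_b)}} :=
  [set T | tiling T.1 && coloring T.1 T.2].

Definition h (a b : nat) (j : int) : nat :=
  match j with
  | Posz n => #|colored_tilings a b n|
  | Negz _ => 0
  end.

Arguments h a%_N b%_N j%_R.

Lemma h0 (a b : nat) : h a b 0 = 1.
Proof.
have S0 (B : {set 'I_0}) : B = set0 by apply/setP => -[].
have nm : monomer (set0 : {set 'I_0}) = false by apply/existsP => -[[]].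
have nd : dimer (set0 : {set 'I_0}) = false by apply/existsP => -[[]].
apply/eqP/cards1P; exists (set0, [ffun=> None]).
apply/setP => -[P c]; rewrite !inE /=; apply/andP/eqP.
  case=> /andP[/and3P[_ _ P0] _] /forallP cP.
  congr pair; first by apply/setP => B; rewrite inE (S0 B) (negPf P0).
  apply/ffunP => B; rewrite ffunE; have := cP B; rewrite (S0 B).
  by case: (c set0) => [[x|x]|] //; rewrite ?nm ?nd andbF.
case=> -> ->; split; last by apply/forallP => B; rewrite ffunE inE.
apply/andP; split; last by apply/forallP => B; rewrite inE.
apply/and3P; split; last by rewrite inE.
  by apply/eqP/setP => -[].
by apply/trivIsetP => A B; rewrite inE.
Qed.

(* Main.v *)
(** Summing over tilings the product of the numbers of admissible colors of the
    tiles expresses [h n] as a weighted count of partitions, which can be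
    expanded according to the block containing a given hexagon.  Expanding at
    the last hexagon [n], and, when it is paired with [n - 2], again at [n - 1]
    (whose only possible partner is then [n - 3]), gives
      [h n = a h (n-1) + b h (n-2) + a b h (n-3) + b^2 h (n-4)]  for [n >= 1].
    By this recurrence the right-hand side of the theorem takes the same value
    at [(m + 1, n)] and [(m, n + 1)], and at [(0, n)] it is [h n]. *)
Require Import Defs.
From mathcomp Require Import all_boot all_order all_algebra.
From mathcomp Require Import zify ring.

Set Implicit Arguments.
Unset Strict Implicit.
Unset Printing Implicit Defensive.

(** * Weighted counts of set partitions *)

Definition partition_weight (T : finType) (w : {set T} -> nat) (D : {set T}) :=
  \sum_(P | partition P D) \prod_(B in P) w B.

(** Group the partitions by their block [B] containing [x]; deleting [B] is a bijection onto the
    partitions of [D :\: B]. *)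
Lemma partition_weight_rec (T : finType) (w : {set T} -> nat) (D : {set T}) x :
    x \in D ->
  partition_weight w D =
    \sum_(B : {set T} | (x \in B) && (B \subset D))
      w B * partition_weight w (D :\: B).
Proof.
move=> Dx; rewrite /partition_weight.
rewrite (partition_big (fun P => pblock P x)
           (fun B => (x \in B) && (B \subset D))) => [|P partP]; last first.
  have cPx : x \in cover P by rewrite (cover_partition partP).
  by rewrite mem_pblock cPx (partitionS partP) ?pblock_mem.
apply: eq_bigr => B /andP[Bx sBD].
rewrite big_distrr (reindex_onto (setU [set B]) (fun P => P :\ B)) /=;
  last first.
  move=> P /andP[partP /eqP <-]; apply: setD1K.
  by rewrite pblock_mem // (cover_partition partP).
(* As [x] lies in [B], [B] is new to [P]: adding it is undone by deleting it, and contributes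
   exactly one factor [w B]. *)
have notinP P : partition P (D :\: B) -> B \notin P.
  move=> partP; apply/negP => /(partitionS partP)/subsetP/(_ x Bx).
  by rewrite inE Bx.
have defP P : [&& partition (B |: P) D, pblock (B |: P) x == B
                & (B |: P) :\ B == P] = partition P (D :\: B).
  apply/and3P/idP => [[partP _ /eqP <-]|partP].
    by apply: partitionD1; rewrite ?setU11.
  have partBP : partition (B |: P) D.
    have := @partitionU1 _ P (D :\: B) B partP.
    have -> : B :|: (D :\: B) = D.
      by rewrite -{2}(setID D B) (setIidPr sBD).
    apply; first by apply/set0Pn; exists x.
    by rewrite disjoint_sym disjoints_subset setDE subsetIr.
  split=> //; last by rewrite setU1K ?notinP.
  by rewrite (def_pblock (partition_trivIset partBP) (setU11 _ _)).
under eq_bigl do rewrite -andbA defP.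
by apply: eq_bigr => P /notinP nPB; rewrite big_setU1.
Qed.

(** Taking images blockwise is a bijection on partitions, with preimages as inverse. *)
Lemma partition_weight_imset (T U : finType) (f : T -> U)
    (w : {set T} -> nat) (v : {set U} -> nat) (D : {set T}) :
    injective f -> (forall B : {set T}, v (f @: B) = w B) ->
  partition_weight v (f @: D) = partition_weight w D.
Proof.
move=> injf vw; rewrite /partition_weight.
have fK (B : {set T}) : f @^-1: (f @: B) = B.
  by apply/setP => x; rewrite inE mem_imset.
pose fI (B : {set T}) := f @: B; pose fV (C : {set U}) := f @^-1: C.
rewrite (reindex_onto (fun P : {set {set T}} => fI @: P)
                      (fun Q : {set {set U}} => fV @: Q)) => [|Q partQ].
  apply: eq_big => [P | P _]; last first.
    rewrite big_imset => [|B C _ _]; first by apply: eq_bigr => B _; apply: vw.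
    exact: imset_inj.
  rewrite imset_partition // -imset_comp (eq_imset _ (g := id)) //.
  by rewrite imset_id eqxx andbT.
rewrite -imset_comp (eq_in_imset (g := id)) ?imset_id // => C QC /=.
(* The image of the preimage is all of [C] because [C], a block of [Q], lies in [f @: D]. *)
apply/setP => y; apply/imsetP/idP => [[x] | Cy]; first by rewrite inE => ? ->.
have /imsetP[x _ yx] := subsetP (partitionS partQ QC) y Cy.
by exists x; rewrite // inE -yx.
Qed.

(** * Colored tilings as weighted partitions *)

Definition tile_weight (a b n : nat) (B : {set 'I_n}) : nat :=
  a * monomer B + b * dimer B.

(** Colors are chosen independently at each set: outside [P] only [None] is allowed, giving a factor
    1. *)
Lemma card_coloring (a b n : nat) (P : {set {set 'I_n}}) :
  #|[set c | @coloring a b n P c]| = \prod_(B in P) tile_weight a b B.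
Proof.
pose F (B : {set 'I_n}) (o : option ('I_a + 'I_b)) : bool :=
  match o with
  | None => B \notin P
  | Some (inl _) => (B \in P) && monomer B
  | Some (inr _) => (B \in P) && dimer B
  end.
have -> : #|[set c | @coloring a b n P c]| =
   #|(family F : simpl_pred {ffun {set 'I_n} -> option ('I_a + 'I_b)})|.
  by apply: eq_card => c; rewrite inE; apply/forallP/familyP.
rewrite card_family foldrE big_map big_enum /= [RHS]big_mkcond /=.
apply: eq_bigr => B _.
rewrite -sum1_card (eq_bigl (F B)) // big_mkcond (bigD1 None) //=.
rewrite (reindex_omap Some id) => [|[]//].
rewrite (eq_bigl predT) => [|o]; last by rewrite /= eqxx.
rewrite big_sumType /=.
rewrite !sum_nat_const !card_ord /tile_weight.
by case: (B \in P); case: (monomer B); case: (dimer B); rewrite /= ?muln0 ?muln1.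
Qed.

(** A partition with a block that is not a tile has weight 0, so the sum may run over all
    partitions. *)
Lemma h_partition_weight (a b n : nat) :
  h a b n = partition_weight (@tile_weight a b n) [set: 'I_n].
Proof.
rewrite /= /colored_tilings -sum1_card.
rewrite (eq_bigl (fun T : {set {set 'I_n}} * _ =>
    tiling T.1 && @coloring a b n T.1 T.2)) => [|T]; last by rewrite inE.
rewrite -(pair_big_dep (@tiling n) (@coloring a b n) (fun _ _ => 1)) /=.
rewrite /partition_weight [RHS](bigID (@tiling n)) /=.
rewrite [X in _ = _ + X]big1 ?addn0 => [|P /andP[partP]]; last first.
  rewrite /tiling partP /= negb_forall => /existsP[B].
  rewrite negb_imply negb_or => /and3P[PB /negbTE mB /negbTE dB].
  by rewrite (bigD1 B) //= /tile_weight mB dB !muln0.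
apply: eq_big => [P | P _]; first by rewrite /tiling; case: partition.
by rewrite -card_coloring -sum1_card; apply: eq_bigl => c; rewrite inE.
Qed.

(** * Initial segments of a strip and expansion at a hexagon *)

Lemma widen_ord_inj (n N : nat) (le_nN : n <= N) : injective (widen_ord le_nN).
Proof. by move=> i j /(congr1 val) /= /val_inj. Qed.

Lemma tile_weight_widen (a b n N : nat) (le_nN : n <= N) (B : {set 'I_n}) :
  tile_weight a b (widen_ord le_nN @: B) = tile_weight a b B.
Proof.
have injw := @widen_ord_inj n N le_nN.
rewrite /tile_weight; congr (a * nat_of_bool _ + b * nat_of_bool _).
  apply/existsP/existsP => [[i /eqP E] | [i /eqP ->]]; last first.
    by exists (widen_ord le_nN i); rewrite imset_set1.
  have : i \in widen_ord le_nN @: B by rewrite E set11.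
  case/imsetP=> j _ ij; exists j.
  by apply/eqP/(imset_inj injw); rewrite E ij imset_set1.
apply/existsP/existsP => [[i /existsP[j /andP[adj /eqP E]]]
                         |[i /existsP[j /andP[adj /eqP ->]]]]; last first.
  exists (widen_ord le_nN i); apply/existsP; exists (widen_ord le_nN j).
  by rewrite imsetU1 imset_set1 eqxx andbT.
have : i \in widen_ord le_nN @: B by rewrite E set21.
have : j \in widen_ord le_nN @: B by rewrite E set22.
case/imsetP=> j' _ jj' /imsetP[i' _ ii']; exists i'; apply/existsP; exists j'.
apply/andP; split; first by move: adj; rewrite ii' jj'.
by apply/eqP/(imset_inj injw); rewrite E ii' jj' imsetU1 imset_set1.
Qed.

(** Realizes shorter strips inside one type ['I_N], where they can be compared with what remains
    after removing tiles. *)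
Lemma h_prefix (a b n N : nat) : n <= N ->
  h a b n = partition_weight (@tile_weight a b N) [set i : 'I_N | i < n].
Proof.
move=> le_nN; rewrite h_partition_weight.
rewrite -(partition_weight_imset _ (@widen_ord_inj n N le_nN)
            (tile_weight_widen a b le_nN)).
congr partition_weight; apply/setP => i; rewrite inE.
apply/imsetP/idP => [[j _ ->] //=| lt_in].
by exists (Ordinal lt_in) => //; apply/val_inj.
Qed.

(** Among the blocks containing [x], only [[set x]] and the dimers [[set x; y]] have nonzero
    weight. *)
Lemma tiling_weight_rec (a b n : nat) (D : {set 'I_n}) x : x \in D ->
  let Z := partition_weight (@tile_weight a b n) in
  Z D = a * Z (D :\ x) + b * \sum_(y in D | adjacent x y) Z (D :\: [set x; y]).
Proof.
move=> Dx Z; rewrite /Z (partition_weight_rec _ Dx) -/Z.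
rewrite (eq_bigr (fun B => a * monomer B * Z (D :\: B)
                         + b * dimer B * Z (D :\: B))) => [|B _]; last first.
  by rewrite -mulnDl.
rewrite big_split /=; congr (_ + _).
  rewrite (bigD1 [set x]) /=; last by rewrite set11 sub1set.
  have -> : monomer [set x] by apply/existsP; exists x.
  rewrite muln1 big1 ?addn0 // => B /andP[/andP[Bx _] neqB].
  case: (boolP (monomer B)) => [/existsP[y /eqP E]|_]; last by rewrite muln0.
  by move: Bx neqB; rewrite E inE => /eqP->; rewrite eqxx.
rewrite (bigID (@dimer n)) /= [X in _ + X]big1 ?addn0; last first.
  by move=> B /andP[_ /negbTE->]; rewrite muln0.
(* No hexagon is adjacent to itself, so the dimer determines the partner of [x]. *)
have injx : {in [pred y in D | adjacent x y] &, injective (fun y => [set x; y])}.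
  move=> y z /andP[_ xy] /andP[_ xz] /setP/(_ y); rewrite !inE eqxx orbT.
  by case: eqP xy => [->|_ _ /esym/eqP //]; rewrite /adjacent; lia.
rewrite -(big_imset (fun B => Z (D :\: B)) injx) big_distrr /=.
apply: eq_big => [B | B /andP[_ ->]]; last by rewrite muln1.
apply/andP/imsetP => [[/andP[Bx sBD]] | [y]].
  case/existsP=> i /existsP[j /andP[adj /eqP E]]; move: Bx sBD.
  rewrite E subUset !sub1set !inE => /orP[/eqP-> | /eqP->] /andP[Di Dj].
    by exists j => //; rewrite inE Dj.
  exists i; last by rewrite setUC.
  by rewrite inE Di /=; move: adj; rewrite /adjacent; lia.
rewrite inE => /andP[Dy adj] ->; rewrite set21 subUset !sub1set Dx Dy; split=> //.
by apply/existsP; exists x; apply/existsP; exists y; rewrite adj eqxx.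
Qed.

(** Listing the partners explicitly lets the sum be unfolded term by term. *)
Lemma tiling_weight_rec_seq (a b n : nat) (D : {set 'I_n}) x (s : seq 'I_n) :
    x \in D -> uniq s -> (forall y, (y \in s) = (y \in D) && adjacent x y) ->
  let Z := partition_weight (@tile_weight a b n) in
  Z D = a * Z (D :\ x) + b * \sum_(y <- s) Z (D :\: [set x; y]).
Proof.
move=> Dx uniq_s sE Z; rewrite /Z (tiling_weight_rec _ _ Dx) -/Z.
congr (_ + b * _); rewrite big_uniq //=.
by apply: eq_bigl => y; rewrite sE.
Qed.

(** * The four-term recurrence *)

Ltac prefix_eq :=
  congr partition_weight; apply/setP => -[i lti]; rewrite !inE -!val_eqE /=; lia.

Lemma h_rec (a b n : nat) :
  h a b n.+1 = a * h a b n + b * h a b (n%:Z - 1) + a * b * h a b (n%:Z - 2)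
               + b ^ 2 * h a b (n%:Z - 3).
Proof.
have top N (lt : N < N.+1) (s : seq 'I_N.+1) : uniq s ->
    (forall y, (y \in s) = adjacent (Ordinal lt) y) ->
    h a b N.+1 = a * h a b N + b * \sum_(y <- s)
      partition_weight (@tile_weight a b N.+1) (setT :\: [set Ordinal lt; y]).
  move=> us sE; rewrite h_partition_weight.
  rewrite (tiling_weight_rec_seq _ _ (in_setT (Ordinal lt)) us).
    rewrite (h_prefix a b (leqnSn N)); congr (a * _ + _); prefix_eq.
  by move=> y; rewrite sE inE.
(* For [n] equal to 0, 1 or 2 some partners do not exist; the corresponding terms vanish since [h]
   is 0 at negative arguments. *)
case: n => [|[|[|n]]].
- rewrite (top 0 isT [::]) // ?big_nil; first by rewrite /=; lia.
  by move=> [y lty]; rewrite in_nil /adjacent /=; lia.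
- rewrite (top 1 isT [:: Ordinal (isT : 0 < 2)]) //; last first.
    by move=> [y lty]; rewrite /adjacent /= !inE -val_eqE /=; lia.
  rewrite big_seq1.
  have -> : (1%:Z - 1 = 0%N)%R by [].
  have -> : (1%:Z - 2 = Negz 0)%R by [].
  have -> : (1%:Z - 3 = Negz 1)%R by [].
  rewrite (h_prefix a b (leq0n 2)) /= !muln0 !addn0.
  congr (_ + b * _); prefix_eq.
- rewrite (top 2 isT [:: Ordinal (isT : 1 < 3); Ordinal (isT : 0 < 3)]) //;
    last first.
    by move=> [y lty]; rewrite /adjacent /= !inE -!val_eqE /=; lia.
  rewrite big_cons big_seq1.
  have -> : (2%:Z - 1 = 1%N)%R by [].
  have -> : (2%:Z - 2 = 0%N)%R by [].
  have -> : (2%:Z - 3 = Negz 0)%R by [].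
  (* With 2 and 0 paired, only 1 remains and must be a monomer. *)
  rewrite [X in b * (_ + X)](@tiling_weight_rec_seq _ _ _ _
    (Ordinal (isT : 1 < 3)) [::]) //; last 2 first.
  + by rewrite !inE.
  + by move=> [y lty]; rewrite in_nil /adjacent /= !inE -!val_eqE /=; lia.
  rewrite big_nil muln0 addn0 (@h_prefix a b 1 3) // (@h_prefix a b 0 3) //.
  rewrite /= muln0 addn0 mulnDr mulnA (mulnC b a) addnA.
  congr (_ + b * _ + _ * _); prefix_eq.
have lt1 : n.+1 < n.+4 by lia.
have lt2 : n.+2 < n.+4 by lia.
have lt0 : n < n.+4 by lia.
rewrite (top n.+3 (ltnSn _) [:: Ordinal lt2; Ordinal lt1]) //; last 2 first.
- by rewrite /= inE -val_eqE /=; lia.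
- by move=> [y lty]; rewrite /adjacent /= !inE -!val_eqE /=; lia.
rewrite big_cons big_seq1.
have -> : (n.+3%:Z - 1 = n.+2)%R by lia.
have -> : (n.+3%:Z - 2 = n.+1)%R by lia.
have -> : (n.+3%:Z - 3 = n)%R by lia.
(* Pairing [n.+3] with [n.+1] leaves [n.+2] with the single neighbor [n]: as a monomer it leaves the
   first [n.+1] hexagons, paired with [n] the first [n]. *)
rewrite [X in b * (_ + X)](@tiling_weight_rec_seq _ _ _ _
  (Ordinal lt2) [:: Ordinal lt0]) //; last 2 first.
- by rewrite !inE -!val_eqE /=; lia.
- by move=> [y lty]; rewrite /adjacent /= !inE -!val_eqE /=; lia.
rewrite big_seq1 (h_prefix a b (ltnW lt0)) (h_prefix a b (ltnW lt1)).
rewrite (h_prefix a b (ltnW lt2)).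
rewrite !mulnDr !mulnA (mulnC b a) !addnA.
congr (_ + b * _ + _ * _ + _ * _); prefix_eq.
Qed.

(** * Addition formula by induction *)

Theorem theorem5 (a b : nat) (ha : 0 < a) (hb : 0 < b)
  (m n : int) (hm : (0 <= m)%R) (hn : (0 <= n)%R) :
  h a b (m + n) =
    h a b m * h a b n
    + h a b (m - 1) * (b * h a b (n - 1) + a * b * h a b (n - 2)
                       + b ^ 2 * h a b (n - 3))
    + h a b (m - 2) * (a * b * h a b (n - 1) + b ^ 2 * h a b (n - 2))
    + b ^ 2 * h a b (n - 1) * h a b (m - 3).
Proof.
case: m hm => // m _; case: n hn => // n _; elim: m n => [|m IHm] n.
  by rewrite GRing.add0r h0 /=; lia.
(* A unit moves from [m.+1] to [n], so the induction hypothesis applies at [n.+1]. *)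
have -> : (m.+1%:Z + n = m%:Z + n.+1)%R by lia.
(* Once [h] is expanded at [m.+1] and at [n.+1], both sides are the same polynomial in [a], [b] and
   the remaining values of [h]. *)
rewrite IHm (h_rec a b m) (h_rec a b n).
have sub1 k : (k.+1%:Z - 1 = k)%R by lia.
have sub2 k : (k.+1%:Z - 2 = k%:Z - 1)%R by lia.
have sub3 k : (k.+1%:Z - 3 = k%:Z - 2)%R by lia.
rewrite !sub1 !sub2 !sub3.
ring.
Qed.
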